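(* Let $V$ be an admissible $(\mathfrak g,K)$-module and let $V^+$ be the span of its $K$-highest weight vectors. As operators on $V^+$ (i.e. when applied to $K$-highest weight vectors), the following identities hold: $$[A_{\alpha+\beta+\gamma},A_\beta]=Q(H_\alpha+H_\gamma+2),\qquad [A_{\alpha+\beta},A_{\beta+\gamma}]=Q(H_\alpha-H_\gamma),$$ $$[B_\beta,B_{\alpha+\beta+\gamma}]=R(H_\alpha+H_\gamma+2),\qquad [B_{\alpha+\beta},B_{\beta+\gamma}]=R(H_\gamma-H_\alpha).$$
   Context: Let $\mathfrak g=\mathfrak{sl}(4,\mathbb C)$ with matrix units $E_{ij}$, and let $K=S(U(2)\times U(2))$ (block diagonal) be the maximal compact subgroup of $SU(2,2)$. Put $H_\alpha=E_{11}-E_{22}$, $H_\beta=E_{22}-E_{33}$, $H_\gamma=E_{33}-E_{44}$; $X_\alpha=E_{12}$, $X_\beta=E_{23}$, $X_\gamma=E_{34}$, $X_{\alpha+\beta}=E_{13}$, $X_{\beta+\gamma}=E_{24}$, $X_{\alpha+\beta+\gamma}=E_{14}$; and $Y_\delta=X_\delta^{t}$ (transpose) for each positive root $\delta$. Put $H_0=H_\alpha+2H_\beta+H_\gamma$. $V$ is an admissible $(\mathfrak g,K)$-module. A $K$-highest weight vector of weight $(n,k,m)$ ($n,m\in\mathbb Z_{\ge0}$, $k\in\mathbb Z$) is $v\in V$ with $X_\alpha v=X_\gamma v=0$, $H_\alpha v=nv$, $H_\gamma v=mv$, $H_0v=kv$ (so $H_\beta v=\tfrac12(k-n-m)v$).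 $V^+$ is the span of all such vectors. The following operators map $V^+$ to itself (products are compositions, the rightmost factor acting first): $A_{\alpha+\beta+\gamma}=X_{\alpha+\beta+\gamma}$; $A_{\alpha+\beta}=X_{\alpha+\beta}(H_\gamma+1)+Y_\gamma X_{\alpha+\beta+\gamma}$; $A_{\beta+\gamma}=X_{\beta+\gamma}(H_\alpha+1)-Y_\alpha X_{\alpha+\beta+\gamma}$; $A_\beta=X_\beta(H_\alpha+1)(H_\gamma+1)-Y_\alpha X_{\alpha+\beta}(H_\gamma+1)+Y_\gamma X_{\beta+\gamma}(H_\alpha+1)-Y_\alpha Y_\gamma X_{\alpha+\beta+\gamma}$; $B_{\alpha+\beta+\gamma}=Y_{\alpha+\beta+\gamma}(H_\alpha+1)(H_\gamma+1)+Y_\alpha Y_{\beta+\gamma}(H_\gamma+1)-Y_\gamma Y_{\alpha+\beta}(H_\alpha+1)-Y_\alpha Y_\gamma Y_\beta$; $B_{\alpha+\beta}=Y_{\alpha+\beta}(H_\alpha+1)+Y_\alpha Y_\beta$; $B_{\beta+\gamma}=Y_{\beta+\gamma}(H_\gamma+1)-Y_\gamma Y_\beta$; $B_\beta=Y_\beta$; $Q=X_{\alpha+\beta}X_{\beta+\gamma}-X_\beta X_{\alpha+\beta+\gamma}$; $R=Y_{\alpha+\beta}Y_{\beta+\gamma}-Y_\beta Y_{\alpha+\beta+\gamma}$. Commutators are $[S,T]=ST-TS$. *)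

(* Defs.v *)
From HB Require Import structures.
From mathcomp Require Import all_boot all_order all_algebra.
From mathcomp Require Import complex.
From mathcomp Require Import boolp classical_sets functions reals.
From mathcomp Require Import topology normedtype sequences.

Set Implicit Arguments.
Unset Strict Implicit.
Unset Printing Implicit Defensive.

Import Order.TTheory GRing.Theory Num.Theory.
Import numFieldNormedType.Exports.

Local Open Scope classical_set_scope.
Local Open Scope ring_scope.
Local Open Scope complex_scope.
Local Open Scope sesquilinear_scope.

Section Span.
Variables (F : fieldType) (V : lmodType F).

Definition lspan (P : set V) : set V :=
  [set v | exists (n : nat) (c : 'I_n -> F) (w : 'I_n -> V),
     (forall i, P (w i)) /\ v = \sum_(i < n) c i *: w i].

Definition fin_dim_set (P : set V) : Prop :=
  exists s : seq V, P `<=` lspan [set` s].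

End Span.

Section GKModules.
Variable R : realType.
(* C^o is C with the topology of its modulus. *)
Local Notation C := R[i].

Definition block_diag (A : 'M[C]_4) : Prop :=
  forall i j : 'I_4, (i < 2)%N != (j < 2)%N -> A i j = 0.

(* S(U(2) x U(2)), as a set of 4 x 4 matrices *)
Definition inK : set 'M[C]_4 :=
  [set k | [/\ block_diag k, k \is unitarymx & \det k = 1]].

(* the (real) Lie algebra of S(U(2) x U(2)) *)
Definition inLieK : set 'M[C]_4 :=
  [set X | [/\ block_diag X, X^t* = - X & \tr X = 0]].

Definition in_sl4 : set 'M[C]_4 := [set X | \tr X = 0].

(* the entrywise sum of the (always convergent) exponential series *)
Definition mexp (X : 'M[C]_4) : 'M[C]_4 :=
  \matrix_(i, j) lim ((fun N : nat =>
    (\sum_(l < N) (l`!%:R : C)^-1 *: X ^+ l) i j : C^o) @ \oo).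

(* A locally finite continuous action of K on a complex vector space.  Vectors
   kact k v with v fixed stay in a finite-dimensional subspace, whose canonical
   topology is the one defined by the linear functionals; linear functionals of
   a subspace extend to V, so continuity of k |-> kact k v is tested on
   functionals of V.  Only the values of kact on K matter. *)
Record K_module (V : lmodType C) (kact : 'M[C]_4 -> V -> V) : Prop := {
  kact_linear : forall k, inK k -> linear (kact k);
  kact1 : forall v, kact 1%:M v = v;
  kactM : forall k l v, inK k -> inK l -> kact (k *m l) v = kact k (kact l v);
  kact_finite : forall v, fin_dim_set [set kact k v | k in inK];
  kact_continuous : forall (f : {scalar V}) (v : V),
    {within (inK : set 'M[C^o]_4),
      continuous (fun k : 'M[C^o]_4 => f (kact k v) : C^o)} }.

(* Only the values of gact on trace-zero matrices matter. *)
Record sl4_module (V : lmodType C) (gact : 'M[C]_4 -> V -> V) : Prop := {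
  gact_linear : forall X, in_sl4 X -> linear (gact X);
  gact_linearl : forall (a : C) X Y v, in_sl4 X -> in_sl4 Y ->
    gact (a *: X + Y) v = a *: gact X v + gact Y v;
  gact_bracket : forall X Y v, in_sl4 X -> in_sl4 Y ->
    gact (X *m Y - Y *m X) v = gact X (gact Y v) - gact Y (gact X v) }.

(* The last field says d/dt (exp(tX) v) = X v at t = 0 (t real), the derivative
   being taken in a finite-dimensional subspace containing K v, hence again
   tested on linear functionals. *)
Record gK_module (V : lmodType C) (gact kact : 'M[C]_4 -> V -> V) : Prop := {
  gK_sl4 : sl4_module gact;
  gK_K : K_module kact;
  gK_Ad : forall k X v, inK k -> in_sl4 X ->
    kact k (gact X v) = gact (k *m X *m invmx k) (kact k v);
  gK_diff : forall (f : {scalar V}) X v, inLieK X ->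
    (fun t : R => (f (kact (mexp (t%:C *: X)) v) - f v) / t%:C : C^o)
      @ 0^' --> (f (gact X v) : C^o) }.

Definition irreducible_K_module (W : vectType C)
    (tau : 'M[C]_4 -> W -> W) : Prop :=
  [/\ K_module tau, (0 < \dim {:W})%N
    & forall U : {vspace W},
        (forall k w, inK k -> w \in U -> tau k w \in U) ->
        U = 0%VS \/ U = fullv].

(* The span of this set is the tau-isotypic component of V. *)
Definition isotypic (V : lmodType C) (kact : 'M[C]_4 -> V -> V)
    (W : vectType C) (tau : 'M[C]_4 -> W -> W) : set V :=
  [set v | exists (T : {linear W -> V}) (w : W),
     (forall k x, inK k -> T (tau k x) = kact k (T x)) /\ v = T w].

Definition admissible (V : lmodType C) (kact : 'M[C]_4 -> V -> V) : Prop :=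
  forall (W : vectType C) (tau : 'M[C]_4 -> W -> W),
    irreducible_K_module tau -> fin_dim_set (isotypic kact tau).

(* matrix units, with indices counted from 1 to 4 *)
Definition Emx (i j : nat) : 'M[C]_4 := delta_mx (inord i.-1) (inord j.-1).

Section Operators.
Variables (V : lmodType C) (gact : 'M[C]_4 -> V -> V).

(* a, b, c stand for the simple roots alpha, beta, gamma *)
Definition H_a := gact (Emx 1 1 - Emx 2 2).
Definition H_b := gact (Emx 2 2 - Emx 3 3).
Definition H_c := gact (Emx 3 3 - Emx 4 4).
Definition H_0 :=
  gact ((Emx 1 1 - Emx 2 2) + 2%:R *: (Emx 2 2 - Emx 3 3) + (Emx 3 3 - Emx 4 4)).

Definition X_a := gact (Emx 1 2).
Definition X_b := gact (Emx 2 3).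
Definition X_c := gact (Emx 3 4).
Definition X_ab := gact (Emx 1 3).
Definition X_bc := gact (Emx 2 4).
Definition X_abc := gact (Emx 1 4).

Definition Y_a := gact (Emx 1 2)^T.
Definition Y_b := gact (Emx 2 3)^T.
Definition Y_c := gact (Emx 3 4)^T.
Definition Y_ab := gact (Emx 1 3)^T.
Definition Y_bc := gact (Emx 2 4)^T.
Definition Y_abc := gact (Emx 1 4)^T.

Definition K_highest_weight (n : nat) (k : int) (m : nat) (v : V) : Prop :=
  [/\ X_a v = 0 /\ X_c v = 0, H_a v = n%:R *: v, H_c v = m%:R *: v
    & H_0 v = k%:~R *: v].

Definition Vplus : set V :=
  lspan [set v | exists n k m, K_highest_weight n k m v].

(* the scalar operator z, so that H + 1 reads H \+ cst_op 1 *)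
Definition cst_op (z : C) : V -> V := fun v => z *: v.

Definition A_abc := X_abc.
Definition A_ab := (X_ab \o (H_c \+ cst_op 1)) \+ (Y_c \o X_abc).
Definition A_bc := (X_bc \o (H_a \+ cst_op 1)) \- (Y_a \o X_abc).
Definition A_b :=
  (X_b \o (H_a \+ cst_op 1) \o (H_c \+ cst_op 1))
  \- (Y_a \o X_ab \o (H_c \+ cst_op 1))
  \+ (Y_c \o X_bc \o (H_a \+ cst_op 1))
  \- (Y_a \o Y_c \o X_abc).

Definition B_abc :=
  (Y_abc \o (H_a \+ cst_op 1) \o (H_c \+ cst_op 1))
  \+ (Y_a \o Y_bc \o (H_c \+ cst_op 1))
  \- (Y_c \o Y_ab \o (H_a \+ cst_op 1))
  \- (Y_a \o Y_c \o Y_b).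
Definition B_ab := (Y_ab \o (H_a \+ cst_op 1)) \+ (Y_a \o Y_b).
Definition B_bc := (Y_bc \o (H_c \+ cst_op 1)) \- (Y_c \o Y_b).
Definition B_b := Y_b.

Definition Qop := (X_ab \o X_bc) \- (X_b \o X_abc).
Definition Rop := (Y_ab \o Y_bc) \- (Y_b \o Y_abc).

Definition commutator (S T : V -> V) : V -> V := (S \o T) \- (T \o S).

End Operators.

End GKModules.

Arguments cst_op {R V} z v.

(* Main.v *)
Require Import Defs.
From HB Require Import structures.
From mathcomp Require Import all_boot all_order all_algebra.
From mathcomp Require Import complex.
From mathcomp Require Import boolp classical_sets functions reals.
From mathcomp Require Import topology normedtype sequences.

Import Order.TTheory GRing.Theory Num.Theory.
Local Open Scope ring_scope.
Local Open Scope complex_scope.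

(** The four identities already hold in the enveloping algebra of sl(4), so
    they hold at every vector of [V], not only on the span of the highest
    weight vectors.  The only brackets needed are those of two matrix units
    that are not transposes of each other ([gact_Emx_comm], [gact_Emx_join],
    [gact_Emx_swap]), of a diagonal matrix with a matrix unit ([gact_HC]) and
    of two diagonal matrices ([gact_HH]).

    With these, every product is brought to a normal form: from left to right,
    the lowering operators of K (the units 21 and 43), then the noncompact
    units, which commute with each other within the A-family and within the
    B-family, and finally polynomials in H_alpha and H_gamma, which commute.
    For instance, put p = (H_alpha + 1) v and q = (H_gamma + 1) v; in the
    commutator of A_{alpha+beta+gamma} with A_beta at v all terms cancel except
    X_{alpha+beta} X_{beta+gamma} (p + q)
    - X_beta X_{alpha+beta+gamma} (p + q), that is, Q (p + q).  In each case
    the two normal forms agree as signed sums of monomials applied to v. *)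

(** Proves an equality of sums and differences in a commutative group: with
    everything moved to the left-hand side of an equation to 0, each leading
    term is cancelled by pulling its opposite to the front. *)
Ltac zmod_cancel :=
  apply/eqP; rewrite -subr_eq0; apply/eqP;
  (* The trailing 0 lets addrCA reach the last term as well. *)
  rewrite -[LHS]addr0 ?(opprD, opprK) -?addrA;
  repeat lazymatch goal with
  | |- - ?x + _ = 0 =>
      repeat (lazymatch goal with
              | |- x + _ = 0 => fail
              | |- _ => rewrite (addrCA _ x)
              end);
      rewrite (addNKr x)
  | |- ?x + _ = 0 =>
      repeat (lazymatch goal with
              | |- - x + _ = 0 => fail
              | |- _ => rewrite (addrCA _ (- x))
              end);
      rewrite (addKr x)
  end;
  reflexivity.

Section MatrixUnits.
Variable R : realType.
Local Notation E := (Emx R).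

(** The range of the indices of [Emx], which are counted from 1; outside it
    distinct indices can denote the same row or column. *)
Definition in14 (i : nat) : bool := (0 < i < 5)%N.

Lemma inord_eq i j : in14 i -> in14 j ->
  ((inord i.-1 : 'I_4) == inord j.-1) = (i == j).
Proof.
case: i j => [|i] [|j] //= hi hj.
by rewrite -val_eqE /= !inordK.
Qed.

Lemma mul_Emx i j k l : in14 j -> in14 k -> E i j *m E k l = E i l *+ (j == k).
Proof. by move=> hj hk; rewrite /Emx mul_delta_mx_cond inord_eq. Qed.

Lemma tr_Emx i j : (E i j)^T = E j i.
Proof. by rewrite /Emx trmx_delta. Qed.

Lemma mxtrace_Emx i j : in14 i -> in14 j -> \tr (E i j) = (i == j)%:R.
Proof.
move=> hi hj; rewrite /Emx /mxtrace (bigD1 (inord i.-1)) //= big1 ?addr0.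
  by rewrite mxE eqxx /= inord_eq.
by move=> k /negPf hk; rewrite mxE hk.
Qed.

Lemma Emx_sl4 i j : in14 i -> in14 j -> i != j -> in_sl4 (E i j).
Proof. by move=> hi hj /negPf hij; rewrite /in_sl4 /= mxtrace_Emx ?hij. Qed.

Lemma H_sl4 i j : in14 i -> in14 j -> in_sl4 (E i i - E j j).
Proof.
by move=> hi hj; rewrite /in_sl4 /= linearB /= !mxtrace_Emx // !eqxx subrr.
Qed.

End MatrixUnits.

Section Relations.
Variables (R : realType) (V : lmodType R[i]) (gact : 'M[R[i]]_4 -> V -> V).
Hypothesis gact_sl4 : sl4_module gact.
Local Notation E := (Emx R).
Local Notation e i j := (gact (Emx R i j)).
Local Notation h i j := (gact (Emx R i i - Emx R j j)).

Lemma gactD X u w : in_sl4 X -> gact X (u + w) = gact X u + gact X w.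
Proof.
by move=> hX; have := gact_linear gact_sl4 hX 1 u w; rewrite !scale1r.
Qed.

Lemma gactN X u : in_sl4 X -> gact X (- u) = - gact X u.
Proof.
move=> hX; have h0 : gact X 0 = 0.
  by apply: (addIr (gact X 0)); rewrite -gactD // !add0r.
by apply: (addIr (gact X u)); rewrite -gactD // !addNr.
Qed.

Lemma gact0l v : gact 0 v = 0.
Proof.
have h0 : in_sl4 (0 : 'M[R[i]]_4) by rewrite /in_sl4 /= linear0.
by have := gact_bracket gact_sl4 v h0 h0; rewrite mul0mx !subrr.
Qed.

Lemma gactZl (a : R[i]) X v : in_sl4 X -> gact (a *: X) v = a *: gact X v.
Proof.
move=> hX; have h0 : in_sl4 (0 : 'M[R[i]]_4) by rewrite /in_sl4 /= linear0.
by rewrite -[a *: X]addr0 (gact_linearl gact_sl4) // gact0l addr0.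
Qed.

Lemma gactC X Y v : in_sl4 X -> in_sl4 Y ->
  gact X (gact Y v) = gact Y (gact X v) + gact (X *m Y - Y *m X) v.
Proof. by move=> hX hY; rewrite (gact_bracket gact_sl4) // addrC subrK. Qed.

Lemma gact_EmxD i j u w : [&& in14 i, in14 j & i != j] ->
  e i j (u + w) = e i j u + e i j w.
Proof. by case/and3P=> *; apply/gactD/Emx_sl4. Qed.

Lemma gact_EmxN i j u : [&& in14 i, in14 j & i != j] -> e i j (- u) = - e i j u.
Proof. by case/and3P=> *; apply/gactN/Emx_sl4. Qed.

Lemma gact_HD i j u w : in14 i && in14 j -> h i j (u + w) = h i j u + h i j w.
Proof. by case/andP=> *; apply/gactD/H_sl4. Qed.

Lemma gact_HN i j u : in14 i && in14 j -> h i j (- u) = - h i j u.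
Proof. by case/andP=> *; apply/gactN/H_sl4. Qed.

Lemma gact_Emx_comm i j k l v :
  [&& in14 i, in14 j, in14 k, in14 l, i != j & k != l] ->
  j != k -> i != l -> e i j (e k l v) = e k l (e i j v).
Proof.
case/and5P=> hi hj hk hl /andP[hij hkl] /negPf jk /negPf il.
rewrite gactC; [|exact: Emx_sl4..].
by rewrite !mul_Emx // [l == i]eq_sym jk il subr0 gact0l addr0.
Qed.

(** [[E_ij, E_jl] = E_il] when the three indices are distinct. *)
Lemma gact_Emx_join i j l v :
  [&& in14 i, in14 j, in14 l, i != j, j != l & i != l] ->
  e i j (e j l v) = e j l (e i j v) + e i l v.
Proof.
case/and5P=> hi hj hl hij /andP[hjl il].
rewrite gactC; [|exact: Emx_sl4..].
by rewrite !mul_Emx // eqxx [l == i]eq_sym (negPf il) subr0.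
Qed.

(** [[E_ij, E_ki] = - E_kj] when the three indices are distinct. *)
Lemma gact_Emx_swap i j k v :
  [&& in14 i, in14 j, in14 k, i != j, k != i & k != j] ->
  e i j (e k i v) = e k i (e i j v) - e k j v.
Proof.
case/and5P=> hi hj hk hij /andP[hki hkj].
by rewrite (gact_Emx_join k i j) ?addrK // hi hj hk hij hki.
Qed.

(** The bracket of a diagonal matrix with a matrix unit, with the weight of
    the latter written as an integer. *)
Lemma gact_HC i j k l v :
  [&& in14 i, in14 j, in14 k, in14 l & k != l] ->
  h i j (e k l v) = e k l (h i j v)
    + e k l v *~ ((i == k)%:R - (i == l)%:R - (j == k)%:R + (j == l)%:R).
Proof.
case/and5P=> hi hj hk hl hkl.
rewrite gactC; [|exact: H_sl4|exact: Emx_sl4]; congr (_ + _).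
rewrite -scaler_int -gactZl; last exact: Emx_sl4.
congr (gact _ v).
rewrite mulmxBl mulmxBr !mul_Emx // [l == i]eq_sym [l == j]eq_sym scaler_int.
have fix_l m : E m l *+ (m == k) = E k l *~ (m == k)%:R.
  by case: eqP => [->|] //=.
have fix_r m : E k m *+ (m == l) = E k l *~ (m == l)%:R.
  by case: eqP => [->|] //=.
by rewrite !fix_l !fix_r mulrzDr !mulrzBr opprD opprK addrACA addrA.
Qed.

Lemma gact_HC0 i j k l v :
  [&& in14 i, in14 j, in14 k, in14 l & k != l] ->
  (i == k)%:R - (i == l)%:R - (j == k)%:R + (j == l)%:R = 0 :> int ->
  h i j (e k l v) = e k l (h i j v).
Proof. by move=> hkl w0; rewrite gact_HC // w0 addr0. Qed.

Lemma gact_HC1 i j k l v :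
  [&& in14 i, in14 j, in14 k, in14 l & k != l] ->
  (i == k)%:R - (i == l)%:R - (j == k)%:R + (j == l)%:R = 1 :> int ->
  h i j (e k l v) = e k l (h i j v) + e k l v.
Proof. by move=> hkl w1; rewrite gact_HC // w1. Qed.

Lemma gact_HH i j k l v : [&& in14 i, in14 j, in14 k & in14 l] ->
  uniq [:: i; j; k; l] ->
  h i j (h k l v) = h k l (h i j v).
Proof.
case/and4P=> hi hj hk hl /=; rewrite !inE !negb_or.
case/and4P=> /and3P[ij ik il] /andP[jk jl] kl _.
rewrite gactC; [|exact: H_sl4..].
rewrite mulmxBl !mulmxBr mulmxBl mulmxBl !mul_Emx //.
rewrite ![k == _]eq_sym ![l == _]eq_sym.
rewrite !(negPf ik, negPf il, negPf jk, negPf jl) !mulr0n !subr0.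
by rewrite gact0l addr0.
Qed.

Lemma cst_op1 (v : V) : cst_op (1 : R[i]) v = v.
Proof. exact: scale1r. Qed.

Ltac unfold_ops :=
  rewrite /commutator /A_abc /A_ab /A_bc /A_b /B_abc /B_ab /B_bc /B_b
    /Qop /Rop /H_a /H_c /X_a /X_b /X_c /X_ab /X_bc /X_abc
    /Y_a /Y_b /Y_c /Y_ab /Y_bc /Y_abc !tr_Emx /= ?cst_op1
    /cst_op ?scaler_nat ?mulr2n.

(* In the rewriting lists below, [gact_HC1] and [gact_HC0] move H_alpha (12)
   and H_gamma (34) to the right of operators of weight 1 and 0; [gact_HH]
   fixes the order of H_alpha and H_gamma; [gact_Emx_join] and [gact_Emx_swap]
   move 21 and 43 to the left of noncompact units; and [gact_Emx_comm] orders
   the commuting units. *)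

Lemma commutator_A_abc_A_b v :
  commutator (A_abc gact) (A_b gact) v
    = (Qop gact \o (H_a gact \+ H_c gact \+ cst_op 2%:R)) v.
Proof.
unfold_ops.
rewrite ?(gact_EmxD, gact_EmxN, gact_HD, gact_HN,
  gact_HC1 1 2 1 4, gact_HC1 3 4 1 4,
  gact_Emx_swap 1 4 2, gact_Emx_join 1 4 3, gact_Emx_join 2 4 3,
  gact_Emx_comm 1 4 2 3, gact_Emx_comm 1 4 1 3, gact_Emx_comm 1 4 2 4,
  gact_Emx_comm 2 4 1 3) //.
zmod_cancel.
Qed.

Lemma commutator_A_ab_A_bc v :
  commutator (A_ab gact) (A_bc gact) v
    = (Qop gact \o (H_a gact \- H_c gact)) v.
Proof.
unfold_ops.
rewrite ?(gact_EmxD, gact_EmxN, gact_HD, gact_HN,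
  gact_HC1 3 4 1 4, gact_HC1 1 2 1 4, gact_HC1 3 4 2 4, gact_HC1 1 2 1 3,
  gact_HC0 3 4 2 1, gact_HC0 1 2 4 3, gact_HH 3 4 1 2,
  gact_Emx_swap 1 4 2, gact_Emx_swap 1 3 2,
  gact_Emx_join 1 4 3, gact_Emx_join 2 4 3, gact_Emx_comm 4 3 2 1,
  gact_Emx_comm 1 4 1 3, gact_Emx_comm 1 4 2 4, gact_Emx_comm 2 4 1 3) //.
zmod_cancel.
Qed.

Lemma commutator_B_b_B_abc v :
  commutator (B_b gact) (B_abc gact) v
    = (Rop gact \o (H_a gact \+ H_c gact \+ cst_op 2%:R)) v.
Proof.
unfold_ops.
rewrite ?(gact_EmxD, gact_EmxN, gact_HD, gact_HN,
  gact_HC1 3 4 3 2, gact_HC1 1 2 3 2,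
  gact_Emx_join 3 2 1, gact_Emx_swap 3 2 4, gact_Emx_swap 3 1 4,
  gact_Emx_comm 3 2 3 1, gact_Emx_comm 3 2 4 2, gact_Emx_comm 3 2 4 1,
  gact_Emx_comm 4 2 3 1) //.
zmod_cancel.
Qed.

Lemma commutator_B_ab_B_bc v :
  commutator (B_ab gact) (B_bc gact) v
    = (Rop gact \o (H_c gact \- H_a gact)) v.
Proof.
unfold_ops.
rewrite ?(gact_EmxD, gact_EmxN, gact_HD, gact_HN,
  gact_HC1 1 2 4 2, gact_HC1 3 4 3 1, gact_HC1 3 4 3 2, gact_HC1 1 2 3 2,
  gact_HC0 3 4 2 1, gact_HC0 1 2 4 3, gact_HH 3 4 1 2,
  gact_Emx_join 3 2 1, gact_Emx_join 4 2 1,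
  gact_Emx_swap 3 2 4, gact_Emx_swap 3 1 4, gact_Emx_comm 4 3 2 1,
  gact_Emx_comm 3 2 3 1, gact_Emx_comm 3 2 4 2, gact_Emx_comm 3 2 4 1,
  gact_Emx_comm 4 2 3 1) //.
zmod_cancel.
Qed.

End Relations.

Theorem proposition2 (R : realType) (V : lmodType R[i])
    (gact kact : 'M[R[i]]_4 -> V -> V)
    (V_gK : gK_module gact kact) (V_adm : admissible kact) :
  forall v : V, Vplus gact v ->
  [/\ commutator (A_abc gact) (A_b gact) v
        = (Qop gact \o (H_a gact \+ H_c gact \+ cst_op 2%:R)) v,
      commutator (A_ab gact) (A_bc gact) v
        = (Qop gact \o (H_a gact \- H_c gact)) v,
      commutator (B_b gact) (B_abc gact) v
        = (Rop gact \o (H_a gact \+ H_c gact \+ cst_op 2%:R)) v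
    & commutator (B_ab gact) (B_bc gact) v
        = (Rop gact \o (H_c gact \- H_a gact)) v].
Proof.
move=> v _; have [hsl4 _ _ _] := V_gK.
split; [exact: commutator_A_abc_A_b | exact: commutator_A_ab_A_bc
  | exact: commutator_B_b_B_abc | exact: commutator_B_ab_B_bc].
Qed.
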